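(* Let $\mu>0$ and let $n\ge 1$ be an integer. For $\lambda>0$ define $$H(\lambda,\mu):=\mu\lambda\ln\lambda-(1+\mu\lambda)\ln\left(\frac{1+\mu\lambda}{1+\mu}\right),\qquad G(\lambda):=\lambda-1-\ln\lambda .$$ (Geometric) Let $X_1,\dots,X_n$ be i.i.d. geometric random variables (failure model) with mean $\mu$, and let $\bar X_n=(X_1+\cdots+X_n)/n$. Then $$\Pr[\bar X_n\ge\lambda\mu]\le\exp\{-n\cdot H(\lambda,\mu)\}\quad\text{for all }\lambda\in(1,\infty),$$ $$\Pr[\bar X_n\le\lambda\mu]\le\exp\{-n\cdot H(\lambda,\mu)\}\quad\text{for all }\lambda\in(0,1).$$ (Exponential) Let $Y_1,\dots,Y_n$ be i.i.d. exponential random variables with mean $\mu$, and let $\bar Y_n=(Y_1+\cdots+Y_n)/n$. Then $$\Pr[\bar Y_n\ge\lambda\mu]\le\exp\{-n\cdot G(\lambda)\}\quad\text{for all }\lambda\in(1,\infty),$$ $$\Pr[\bar Y_n\le\lambda\mu]\le\exp\{-n\cdot G(\lambda)\}\quad\text{for all }\lambda\in(0,1).$$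
   Context: A geometric random variable (failure model) with parameter $p\in(0,1)$ satisfies $\Pr[X=k]=p(1-p)^k$ for $k=0,1,2,\dots$; its mean is $\mu=(1-p)/p$, i.e. $p=1/(1+\mu)$. An exponential random variable with rate $\rho>0$ has density $\rho e^{-\rho y}$ on $[0,\infty)$; its mean is $\mu=1/\rho$. $\ln$ is the natural logarithm. *)

(* Defs.v *)
From HB Require Import structures.
From mathcomp Require Import all_boot all_order all_algebra.
From mathcomp Require Import all_classical all_reals all_analysis.

Set Implicit Arguments.
Unset Strict Implicit.
Unset Printing Implicit Defensive.

Import Order.TTheory GRing.Theory Num.Theory.
Import numFieldNormedType.Exports.

Local Open Scope classical_set_scope.
Local Open Scope ring_scope.

Definition H {R : realType} (lambda mu : R) : R :=
  mu * lambda * ln lambda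
  - (1 + mu * lambda) * ln ((1 + mu * lambda) / (1 + mu)).

Definition G {R : realType} (lambda : R) : R := lambda - 1 - ln lambda.

Section RandomVariables.
Context {R : realType} {d : measure_display} {T : measurableType d}.
Variable P : probability T R.

(* These masses sum to 1, so a geometric real random variable is almost surely
   a natural number. *)
Definition is_geometric (p : R) (X : {RV P >-> R}) : Prop :=
  0 < p < 1 /\ forall k : nat, pmf X k%:R = p * (1 - p) ^+ k.

Definition is_exponential (rho : R) (Y : {RV P >-> R}) : Prop :=
  0 < rho /\
  forall A : set R, measurable A -> distribution P Y A = exponential_prob rho A.

(* Mutual independence: the product rule for every subfamily. *)
Definition independent (I : finType) (X : I -> {RV P >-> R}) : Prop :=
  forall (J : {set I}) (A : I -> set R),
    (forall i, measurable (A i)) ->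
    P (\bigcap_(i in [set` J]) X i @^-1` A i) =
    (\prod_(i in J) P (X i @^-1` A i))%E.

Definition sample_mean (n : nat) (X : 'I_n -> {RV P >-> R}) (w : T) : R :=
  (\sum_(i < n) X i w) / n%:R.

End RandomVariables.

(* Main.v *)
Require Import Defs.
From HB Require Import structures.
From mathcomp Require Import all_boot all_order all_algebra.
From mathcomp Require Import all_classical all_reals all_analysis.
From mathcomp Require Import measurable_realfun.
From mathcomp Require Import ring lra.

Set Implicit Arguments.
Unset Strict Implicit.
Unset Printing Implicit Defensive.

Import Order.TTheory GRing.Theory Num.Theory.
Import numFieldNormedType.Exports.

Local Open Scope classical_set_scope.
Local Open Scope ring_scope.

(** The four bounds are Chernoff bounds.  Multiplying by a real t of the right
    sign turns either tail event into [t * a <= t * mean], where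
    [a = lambda * mu], so that one inequality, [chernoff_sample_mean], serves
    both tails: if M is the value at t of the moment generating function of
    every variable, then

      P (t * a <= t * mean) <= (exp (- t * a) * M) ^ n.

    It rests on E[exp (t * (X_1 + ... + X_n))] = M ^ n, which has to be derived
    from the product rule for events ([independent_integral_prod]): starting
    from products of indicators, the indicators are traded one at a time for
    arbitrary nonnegative functions.  A single trade is the usual passage from
    sets to functions, [ge0_integral_weighted], which also turns integrals
    against the exponential law into integrals against its density.

    The moment generating functions are p / (1 - (1 - p) exp t) for the
    geometric law, a geometric series, and rho / (rho - t) for the exponential
    law, since exp (t y) times the density of rate rho is proportional to the
    density of rate rho - t.  The bounds are expressed through the mean, so the
    parameter must be recovered from it: p = 1 / (1 + mu) and rho = 1 / mu.
    Both follow from the fact that the mean is the derivative of the moment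
    generating function at 0, which [mean_eq_derive_mgf] gets from the
    inequality 1 + t X <= exp (t X), with equality at t = 0.

    The exponent t is the one that minimises exp (- t * a) * M.  It makes the
    tilted law have mean lambda * mu, and it has the sign of lambda - 1. *)

(** * From sets to functions in an integral *)

Section weighted_integral.
Context d d' {T : measurableType d} {T' : measurableType d'} {R : realType}.
Local Open Scope ereal_scope.
Import HBNNSimple.

(** The measure A |-> \int[m] g * 1_A(X) is the image under X of the measure with
    density g; knowing it on sets determines the integral of every nonnegative
    function, by simple functions and monotone convergence.  With g constant
    equal to 1 this is the transfer formula, with X the identity it is
    integration against a density. *)
Lemma ge0_integral_weighted (m : {measure set T -> \bar R})
    (nu : {measure set T' -> \bar R}) (X : T -> T') (g : T -> R) (h : T' -> R) :
    measurable_fun setT X -> measurable_fun setT g -> (forall x, 0 <= g x)%R ->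
    measurable_fun [set: T'] h -> (forall y, 0 <= h y)%R ->
    (forall A, measurable A -> \int[m]_x (g x * \1_A (X x))%:E = nu A) ->
  \int[m]_x (g x * h (X x))%:E = \int[nu]_y (h y)%:E.
Proof.
move=> mX mg g0 mh h0 gnu.
have mEh : measurable_fun [set: T'] (EFin \o h) by exact/measurable_EFinP.
have hE0 y : setT y -> 0 <= (EFin \o h) y by rewrite lee_fin.
pose s := nnsfun_approx measurableT mEh.
have ms n : measurable_fun [set: T'] (s n) by [].
have cvgs y : (s n y)%:E @[n --> \oo] --> (h y)%:E.
  exact: (cvg_nnsfun_approx measurableT mEh hE0).
have mgs n : measurable_fun [set: T] (fun x => (g x * s n (X x))%:E).
  by apply/measurable_EFinP/measurable_funM => //; exact: measurableT_comp.
transitivity (limn (fun n => \int[nu]_y (s n y)%:E)); last first.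
  rewrite -monotone_convergence //.
  - by apply: eq_integral => y _; apply/cvg_lim => //; exact: cvgs.
  - by move=> n; exact/measurable_EFinP.
  - by move=> n y _; rewrite lee_fin.
  - by move=> y _ a b ab; rewrite lee_fin; exact/lefP/nd_nnsfun_approx.
transitivity (limn (fun n => \int[m]_x (g x * s n (X x))%:E)).
  rewrite -monotone_convergence //.
  - apply: eq_integral => x _; apply/esym/cvg_lim => //.
    under eq_fun do rewrite EFinM.
    by rewrite EFinM; apply: cvgeZl => //; exact: cvgs.
  - by move=> n x _; rewrite lee_fin mulr_ge0.
  - move=> x _ a b ab; rewrite lee_fin ler_wpM2l //.
    exact/lefP/nd_nnsfun_approx.
congr (limn _); apply/funext => n.
have mind (r : R) : measurable_fun [set: T'] (\1_(s n @^-1` [set r]) : T' -> R) by [].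
transitivity (\sum_(r \in range (s n))
    \int[m]_x (g x * (r * \1_(s n @^-1` [set r]) (X x)))%:E).
  rewrite -ge0_integral_fsum //.
  - apply: eq_integral => x _; rewrite fsumEFin //; congr (_%:E).
    by rewrite (fimfunE (s n)) -mulr_fsumr.
  - move=> r; apply/measurable_EFinP/measurable_funM => //.
    by apply: measurable_funM => //; apply: (measurableT_comp (mind r)).
  - move=> r x _; rewrite EFinM mule_ge0 ?lee_fin //.
    exact: nnfun_muleindic_ge0.
transitivity (\sum_(r \in range (s n))
    \int[nu]_y (r * \1_(s n @^-1` [set r]) y)%:E).
  apply: eq_fsbigr => r /[!inE] -[y _ <-].
  under eq_integral do rewrite mulrCA EFinM.
  rewrite ge0_integralZl ?lee_fin //; last 2 first.
  - apply/measurable_EFinP/measurable_funM => //.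
    exact: (measurableT_comp (mind _)).
  - by move=> x _; rewrite lee_fin mulr_ge0.
  rewrite gnu //.
  under [RHS]eq_integral do rewrite EFinM.
  by rewrite ge0_integralZl ?lee_fin //; rewrite ?integral_indic ?setIT //;
     exact/measurable_EFinP.
rewrite -ge0_integral_fsum //.
- by apply: eq_integral => y _; rewrite fsumEFin // -fimfunE.
- by move=> r; exact/measurable_EFinP/measurable_funM.
- by move=> r y _; exact: nnfun_muleindic_ge0.
Qed.

End weighted_integral.

(** * Expectation of a product of independent variables *)

Section independence.
Context {R : realType} {d : measure_display} {T : measurableType d}.
Variable P : probability T R.
Local Open Scope ereal_scope.

(** By induction on a list s of indices, for families in which every f i with i
    outside s is an indicator.  For s empty this is the product rule for
    events.  To add k to s, let A be any measurable set and replace f k by the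
    indicator of A: the induction hypothesis evaluates the measure
    E[g 1_A(X k)], where g is the product of the other factors, as a constant
    multiple of the law of X k, and one integrates f k against this measure.
    Finiteness of the factors makes that constant a real number. *)
Lemma independent_integral_prod (I : finType) (X : I -> {RV P >-> R})
    (f : I -> R -> R) :
    independent X -> (forall i, measurable_fun [set: R] (f i)) ->
    (forall i x, 0 <= f i x)%R ->
    (forall i, \int[P]_w (f i (X i w))%:E < +oo) ->
  \int[P]_w (\prod_i f i (X i w))%:E = \prod_i \int[P]_w (f i (X i w))%:E.
Proof.
move=> indX mf f0 foo.
(* The list enum I contains every index, so the condition is vacuous for it. *)
have: forall i, i \notin enum I -> exists2 A, measurable A & f i = \1_A.
  by move=> i; rewrite mem_enum.
elim: (enum I) f mf f0 foo => [|k s IHs] f mf f0 foo fs.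
  have [A mA fA] : exists2 A : I -> set R,
      (forall i, measurable (A i)) & forall i, f i = \1_(A i).
    have /choice[A AP] i : exists A, measurable A /\ f i = \1_A.
      by have [//|A mA fA] := fs i; exists A.
    by exists A => i; have [] := AP i.
  have mXA i : measurable (X i @^-1` A i) by exact: measurable_funPTI.
  pose B := \bigcap_(i in [set` [set: I]%SET]) X i @^-1` A i.
  have mB : measurable B.
    exact: fin_bigcap_measurable.
  transitivity (\int[P]_w (\1_B w)%:E).
    apply: eq_integral => w _; congr (_%:E).
    rewrite indicE; have [/set_mem Bw|/negP nBw] := boolP (w \in B).
      rewrite big1 // => i _; rewrite fA indicE mem_set //; by apply: Bw; rewrite /= inE.
    have [i nAi] : exists i, ~ (X i @^-1` A i) w.
      apply/existsNP => Aw; apply: nBw; rewrite inE => i _; exact: Aw.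
    by rewrite (bigD1 i) //= fA indicE memNset // mul0r.
  rewrite integral_indic // setIT.
  transitivity (\prod_(i in [set: I]%SET) P (X i @^-1` A i)); first exact: indX.
  rewrite (eq_bigl xpredT) => [|i]; last by rewrite inE.
  apply: eq_bigr => i _; under [RHS]eq_integral do rewrite fA.
  by rewrite (integral_indic P measurableT (mXA i)) setIT.
pose g w := (\prod_(i | i != k) f i (X i w))%R.
pose c := (\prod_(i | i != k) fine (\int[P]_w (f i (X i w))%:E))%R.
have intE i : \int[P]_w (f i (X i w))%:E =
    (fine (\int[P]_w (f i (X i w))%:E))%:E.
  rewrite fineK // ge0_fin_numE //.
  by apply: integral_ge0 => w _; rewrite lee_fin.
have c0 : (0 <= c)%R.
  apply: prodr_ge0 => i _; apply: fine_ge0.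
  by apply: integral_ge0 => w _; rewrite lee_fin.
have cE : \prod_(i | i != k) \int[P]_w (f i (X i w))%:E = c%:E.
  by rewrite -prodEFin; apply: eq_bigr => i _; exact: intE.
rewrite (bigD1 k) //= cE muleC.
under eq_integral do rewrite (bigD1 k) //= mulrC.
have mfX i : measurable_fun [set: T] (f i \o X i) by exact: measurableT_comp.
have mg : measurable_fun [set: T] g.
  rewrite /g; under eq_fun do rewrite -big_filter.
  by apply: measurable_prod => i _; exact: mfX.
rewrite (@ge0_integral_weighted _ _ _ _ _ P
  (mscale (NngNum c0) (distribution P (X k))) (X k) g (f k)) //.
- rewrite ge0_integral_mscale //; last 2 first.
    exact/measurable_EFinP.
    by move=> y _; rewrite lee_fin.
  rewrite ge0_integral_distribution //; first exact/measurable_EFinP.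
  by move=> y; rewrite lee_fin.
- by move=> w; apply: prodr_ge0.
move=> A mA.
have mXA : d.-measurable (X k @^-1` A) by exact: measurable_funPTI.
pose f' i := if i == k then \1_A else f i.
have intA : \int[P]_w (\1_A (X k w))%:E = P (X k @^-1` A).
  by rewrite (integral_indic P measurableT mXA) setIT.
transitivity (\int[P]_w (\prod_i f' i (X i w))%:E).
  apply: eq_integral => w _; rewrite (bigD1 k) //= /f' eqxx mulrC.
  congr (_ * _)%:E; apply: eq_bigr => i /negbTE -> //.
rewrite IHs.
- rewrite (bigD1 k) //= {1}/f' eqxx intA muleC /mscale /=; congr (_ * _).
  by rewrite -cE; apply: eq_bigr => i /negbTE ik; rewrite /f' ik.
- by move=> i; rewrite /f'; case: ifP.
- by move=> i x; rewrite /f'; case: ifP.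
- move=> i; rewrite /f'; case: eqP => [->|_] //.
  by rewrite intA ltey_eq fin_num_measure.
- move=> i ins; rewrite /f'; case: eqP => [_|/eqP ik]; first by exists A.
  by apply: fs; rewrite inE negb_or ik.
Qed.

End independence.

(** * Exponential moments: tail bound and mean *)

Section exponential_moments.
Context {R : realType} {d : measure_display} {T : measurableType d}.
Variable P : probability T R.
Implicit Types X : {RV P >-> R}.

Lemma measurable_expRM (t : R) :
  measurable_fun [set: R] (fun x : R => expR (t * x)).
Proof. by apply: measurableT_comp => //; exact: measurable_funM. Qed.

(** Leaving the sign of t free covers the upper tail (t > 0) and the lower tail
    (t < 0) at once.  On the event, 1 <= exp (n t (mean - a)), so Markov's
    inequality applies to the variable exp (t (X_1 + ... + X_n)). *)
Lemma chernoff_sample_mean (n : nat) (X : 'I_n -> {RV P >-> R}) (t a M : R) :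
    (0 < n)%N -> independent X ->
    (forall i, (\int[P]_w (expR (t * X i w))%:E = M%:E)%E) ->
  (P [set w | (t * a <= t * sample_mean X w)%R]
    <= ((expR (- (t * a)) * M) ^+ n)%:E)%E.
Proof.
move=> n0 indX mgfX.
have n0R : 0 < n%:R :> R by rewrite ltr0n.
have mexpX (i : 'I_n) : measurable_fun [set: T] (fun w => expR (t * X i w)).
  exact: (measurableT_comp (measurable_expRM t)).
have mA : d.-measurable [set w | t * a <= t * sample_mean X w].
  have mf : measurable_fun [set: T] (fun w => t * a <= t * sample_mean X w).
    apply: measurable_fun_ler => //; apply: measurable_funM => //.
    by apply: measurable_funM => //; exact: measurable_sum.
  by move: (mf measurableT [set true]); rewrite setTI; exact.
pose e := expR (- (t * a)) ^+ n.
have e0 : 0 <= e by rewrite exprn_ge0 // expR_ge0.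
have mprod : measurable_fun [set: T] (fun w => \prod_i expR (t * X i w)).
  exact: measurable_prod.
rewrite -[X in (P X <= _)%E]setIT -(integral_indic P measurableT mA).
apply: (@le_trans _ _ (\int[P]_w (e * \prod_i expR (t * X i w))%:E)%E).
  apply: ge0_le_integral => //.
  - exact/measurable_EFinP.
  - exact/measurable_EFinP/measurable_funM.
  - move=> w _; rewrite lee_fin indicE.
    have [/set_mem /= Aw|_] := boolP (w \in _); last first.
      by rewrite mulr_ge0 // prodr_ge0 // => i _; exact: expR_ge0.
    rewrite -expR_sum /e -expRM_natl -expRD -[leLHS]expR0 ler_expR -mulr_sumr.
    move: Aw; rewrite /sample_mean mulrA ler_pdivlMr //.
    by rewrite mulrN mulrC addrC subr_ge0 mulrC.
under eq_integral do rewrite EFinM.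
rewrite ge0_integralZl //; last 2 first.
- exact/measurable_EFinP.
- by move=> w _; rewrite lee_fin prodr_ge0 // => i _; exact: expR_ge0.
rewrite (independent_integral_prod indX (fun=> measurable_expRM t)) //; last first.
  by move=> i; rewrite mgfX ltry.
under eq_bigr do rewrite mgfX.
by rewrite prodEFin -EFinM lee_fin prodr_const card_ord exprMn.
Qed.

(** Since 1 + t X <= exp (t X), the function M t - t mu is at least 1, with
    equality at t = 0: it has a minimum there, so its derivative m - mu
    vanishes.  This avoids both differentiation under the integral sign and a
    direct computation of the mean. *)
Lemma mean_eq_derive_mgf X (mu m a b : R) (M : R -> R) :
    a < 0 < b -> ('E_P[X] = mu%:E)%E ->
    (forall t, t \in `]a, b[ ->
      (\int[P]_w (expR (t * X w))%:E = (M t)%:E)%E) ->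
    (forall t, t \in `]a, b[ -> derivable M t (1 : R)) -> is_derive (0 : R) (1 : R) M m ->
  mu = m.
Proof.
move=> /andP[a0 b0]; rewrite expectation_def => EX mgfX dM dM0.
have ab0 : (0 : R) \in `]a, b[ by rewrite in_itv /= a0.
have mX : measurable_fun [set: T] (EFin \o X) by exact/measurable_EFinP.
have intX : P.-integrable [set: T] (EFin \o X).
  (* A difference of extended reals is finite only if both terms are, hence a
     finite expectation entails integrability. *)
  apply/integrableP; split => //.
  have /andP[posX negX] : (\int[P]_w (EFin \o X)^\+%E w \is a fin_num)%E &&
      (\int[P]_w (EFin \o X)^\-%E w \is a fin_num)%E.
    by rewrite -fin_numB -integralE EX.
  under eq_integral do rewrite -[(`|_|)%E]/((abse \o (EFin \o X)) _) fune_abse.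
  rewrite ge0_integralD //; last 2 first.
  - exact: measurable_funepos.
  - exact: measurable_funeneg.
  by rewrite lte_add_pinfty // ltey_eq ?posX ?negX.
have mgf_ge t : t \in `]a, b[ -> 1 + t * mu <= M t.
  move=> tab; rewrite -lee_fin -mgfX //.
  have mexp : measurable_fun [set: T] (fun w => expR (t * X w)).
    exact: (measurableT_comp (measurable_expRM t)).
  have int1 : P.-integrable [set: T] (EFin \o cst 1).
    exact: finite_measure_integrable_cst.
  have inttX : P.-integrable [set: T] (fun w => (t%:E * (EFin \o X) w)%E).
    exact: integrableZl.
  have -> : ((1 + t * mu)%:E = \int[P]_w (1 + t%:E * (X w)%:E))%E.
    rewrite integralD // integralZl // EX integral_cst //= probability_setT.
    by rewrite mul1e.
  apply: le_integral => //.
  - exact: integrableD.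
  - apply/integrableP; split; first exact/measurable_EFinP.
    under eq_integral do rewrite gee0_abs ?lee_fin ?expR_ge0 //.
    by rewrite mgfX // ltry.
  - by move=> w _; rewrite lee_fin expR_ge1Dx.
have M0 : M 0 = 1.
  apply: EFin_inj; rewrite -mgfX //.
  under eq_integral do rewrite mul0r expR0.
  by rewrite integral_cst //= probability_setT mule1.
pose f := M - mu \*: (@id R).
have fmin : is_derive (0 : R) (1 : R) f 0.
  apply: (@derive1_at_min _ f a b) => //.
  - by rewrite ltW // (lt_trans a0).
  - by move=> t tab; apply: derivableB; [exact: dM|exact: derivableZ].
  - move=> t tab; change (M 0 - mu * 0 <= M t - mu * t).
    by rewrite M0 mulr0 subr0 lerBrDr mulrC mgf_ge.
have fder : is_derive (0 : R) (1 : R) f (m - mu).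
  by rewrite -[X in m - X]mulr1; exact: is_deriveB.
by apply/esym/eqP; rewrite -subr_eq0 -(@derive_val _ _ _ _ _ _ _ fder)
  (@derive_val _ _ _ _ _ _ _ fmin).
Qed.

End exponential_moments.

(** * The geometric law *)

Lemma nneseries_geometric (R : realType) (a z : R) : 0 <= a -> 0 <= z < 1 ->
  (\sum_(0 <= k <oo) (a * z ^+ k)%:E = (a / (1 - z))%:E)%E.
Proof.
move=> a0 /andP[z0 z1]; apply/cvg_lim => //.
under eq_fun do rewrite sumEFin.
apply: cvg_EFin; first exact: nearW.
by apply: cvg_geometric_series; rewrite ger0_norm.
Qed.

Section geometric.
Context {R : realType} {d : measure_display} {T : measurableType d}.
Variable P : probability T R.
Implicit Types X : {RV P >-> R}.

(** The events X = k are disjoint and their masses sum to 1, so they cover the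
    whole space up to a null set; X itself may take other values there. *)
Lemma ge0_integral_geometric (p : R) X (f : R -> R) :
    is_geometric p X -> measurable_fun [set: R] f -> (forall x, 0 <= f x) ->
  (\int[P]_w (f (X w))%:E
    = \sum_(0 <= k <oo) (f k%:R * (p * (1 - p) ^+ k))%:E)%E.
Proof.
move=> [/andP[p0 p1] pmfX] mf f0.
pose F (k : nat) := X @^-1` [set k%:R].
have mF k : d.-measurable (F k) by exact: measurable_funPTI.
have tF : trivIset [set: nat] F.
  apply/trivIsetP => i j _ _ ij; rewrite -subset0 => w [/= Xi Xj].
  by move: ij; rewrite -(eqr_nat R) -Xi -Xj eqxx.
have PF k : P (F k) = (p * (1 - p) ^+ k)%:E.
  by rewrite -pmfX /pmf fineK // fin_num_measure.
have mUF : d.-measurable (\bigcup_k F k) by exact: bigcup_measurable.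
have PUF : P (\bigcup_k F k) = 1%E.
  rewrite measure_bigcup // (eq_eseriesr (fun k _ => PF k)).
  rewrite (@eq_eseriesl _ _ xpredT) => [|k]; last exact: in_setT.
  rewrite nneseries_geometric ?(ltW p0) //; last first.
    by rewrite subr_ge0 (ltW p1) ltrBlDr ltrDl.
  by rewrite opprB addrCA subrr addr0 divff // gt_eqF.
have PN : P (~` \bigcup_k F k) = 0%E by rewrite probability_setC // PUF subee.
have mfX : measurable_fun [set: T] (fun w => (f (X w))%:E).
  by apply/measurable_EFinP; exact: measurableT_comp.
rewrite (ge0_negligible_integral (measurableC mUF) measurableT) //; last first.
  by move=> w _; rewrite lee_fin.
rewrite setTD setCK ge0_integral_bigcup //; last first.
- by move=> w _; rewrite lee_fin.
- exact: measurable_funTS.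
apply: eq_eseriesr => k _.
rewrite EFinM -PF -(integral_cst P (mF k)).
by apply: eq_integral => w /set_mem /= ->.
Qed.

Lemma mgf_geometric (p t : R) X : is_geometric p X -> (1 - p) * expR t < 1 ->
  (\int[P]_w (expR (t * X w))%:E = (p / (1 - (1 - p) * expR t))%:E)%E.
Proof.
move=> gX qt; have [/andP[p0 p1] _] := gX.
rewrite (ge0_integral_geometric gX (measurable_expRM t)) => [|x]; last exact: expR_ge0.
rewrite -nneseries_geometric ?(ltW p0) ?qt ?andbT //; last first.
  by rewrite mulr_ge0 ?expR_ge0 // subr_ge0 ltW.
apply: eq_eseriesr => k _.
by rewrite expRM_natr; congr (_%:E); rewrite exprMn; ring.
Qed.

Lemma geometric_mean (p mu : R) X : is_geometric p X -> ('E_P[X] = mu%:E)%E ->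
  mu = (1 - p) / p.
Proof.
move=> gX EX; have [/andP[p0 p1] _] := gX.
have q0 : 0 < 1 - p by rewrite subr_gt0.
(* The moment generating function is finite exactly for t < b; the lower end -1
   of the interval is an arbitrary negative number. *)
pose b := - ln (1 - p).
have qexp t : t \in `]-1, b[ -> (1 - p) * expR t < 1.
  rewrite in_itv /= => /andP[_ tb].
  by rewrite -[X in X * _]lnK ?posrE // -expRD -[ltRHS]expR0 ltr_expR -ltrBrDl sub0r.
pose M t := p / (1 - (1 - p) * expR t).
have dM t : t \in `]-1, b[ -> is_derive t (1 : R) M
    (p * ((1 - (1 - p) * expR t) ^- 2 * ((1 - p) * expR t))).
  move=> tb; have D0 : 1 - (1 - p) * expR t != 0.
    by rewrite gt_eqF // subr_gt0 qexp.
  have dD : is_derive t (1 : R) (fun s : R => 1 - (1 - p) * expR s)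
      (- ((1 - p) * expR t)).
    by apply: is_derive_eq; rewrite add0r mul1r.
  have dV := is_deriveV (f := fun s : R => 1 - (1 - p) * expR s) D0 dD.
  have := is_deriveZ p dV.
  by rewrite /GRing.scale /= mulrNN.
apply: (@mean_eq_derive_mgf _ _ _ _ X mu _ (-1) b M) => //.
- by rewrite ltrN10 /b oppr_gt0 ln_lt0 // q0 ltrBlDr ltrDl.
- by move=> t tb; exact: mgf_geometric (qexp t tb).
- by move=> t tb; have [] := dM t tb.
have := dM 0; rewrite in_itv /= ltrN10 /b oppr_gt0 ln_lt0 ?q0 ?ltrBlDr ?ltrDl //.
move=> /(_ isT) dM0; apply: is_derive_eq dM0 _.
by rewrite expR0 mulr1; field; rewrite gt_eqF.
Qed.

End geometric.

(** * The exponential law *)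

Section exponential.
Context {R : realType} {d : measure_display} {T : measurableType d}.
Variable P : probability T R.
Implicit Types Y : {RV P >-> R}.

Lemma mgf_exponential (rho t : R) Y : is_exponential rho Y -> t < rho ->
  (\int[P]_w (expR (t * Y w))%:E = (rho / (rho - t))%:E)%E.
Proof.
move=> [rho0 distY] t_rho.
have rt0 : 0 < rho - t by rewrite subr_gt0.
have mexp := measurable_expRM t.
have pdf0 r x : 0 < r -> 0 <= exponential_pdf r x :> R.
  by move=> r0; apply: exponential_pdf_ge0; exact: ltW.
have mpdf := @measurable_exponential_pdf R.
transitivity (\int[distribution P Y]_y (expR (t * y))%:E)%E.
  rewrite ge0_integral_distribution //; exact/measurable_EFinP.
rewrite -(@ge0_integral_weighted _ _ _ _ _ lebesgue_measure
  (distribution P Y) id (exponential_pdf rho) (fun y => expR (t * y))) //;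
  last 3 first.
- exact: mpdf.
- by move=> x; exact: pdf0.
- move=> A mA; transitivity (exponential_prob rho A); last exact/esym/distY.
  rewrite /exponential_prob [RHS]integral_mkcond.
  apply: eq_integral => x _; rewrite patchE indicE.
  by case: (x \in A); rewrite ?mulr1 ?mulr0.
(* Exponential tilting: the density of rate rho times exp (t x) is a constant
   multiple of the density of rate rho - t. *)
transitivity (\int[lebesgue_measure]_x
    ((rho / (rho - t))%:E * (exponential_pdf (rho - t) x)%:E))%E.
  apply: eq_integral => x _; rewrite -EFinM; congr (_%:E).
  have [x0|x0] := ltP x 0; first by rewrite !lt0_exponential_pdf // mul0r mulr0.
  rewrite !exponential_pdfE // mulrA divfK ?gt_eqF // -mulrA -expRD.
  by congr (_ * expR _); ring.
rewrite ge0_integralZl //; last 3 first.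
- by apply/measurable_EFinP; exact: mpdf.
- by move=> x _; rewrite lee_fin pdf0.
- by rewrite lee_fin divr_ge0 ?ltW.
by rewrite integral_exponential_pdf // mule1.
Qed.

Lemma exponential_mean (rho mu : R) Y : is_exponential rho Y ->
  ('E_P[Y] = mu%:E)%E -> mu = rho^-1.
Proof.
move=> eY EY; have [rho0 _] := eY.
pose M t := rho / (rho - t).
have dM t : t \in `]-1, rho[ -> is_derive t (1 : R) M (rho * (rho - t) ^- 2).
  rewrite in_itv /= => /andP[_ tr].
  have D0 : rho - t != 0 by rewrite gt_eqF // subr_gt0.
  have dD : is_derive t (1 : R) (fun s : R => rho - s) (- 1).
    by apply: is_derive_eq; rewrite add0r mul1r.
  have dV := is_deriveV (f := fun s : R => rho - s) D0 dD.
  have := is_deriveZ rho dV.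
  by rewrite /GRing.scale /= mulrNN mulr1.
apply: (@mean_eq_derive_mgf _ _ _ _ Y mu _ (-1) rho M) => //.
- by rewrite ltrN10.
- by move=> t; rewrite in_itv /= => /andP[_ ?]; exact: mgf_exponential.
- by move=> t tb; have [] := dM t tb.
have := dM 0; rewrite in_itv /= ltrN10 rho0 => /(_ isT) dM0.
by apply: is_derive_eq dM0 _; rewrite subr0; field; rewrite gt_eqF.
Qed.

End exponential.

(** * Optimal exponents *)

(** The minimiser of exp (- t lambda mu) p / (1 - (1 - p) exp t) in t, written
    in terms of the mean: setting the logarithmic derivative to 0 gives
    (1 - p) exp t = lambda mu / (1 + lambda mu), where
    1 - p = mu / (1 + mu). *)
Definition geometric_tilt {R : realType} (mu lambda : R) : R :=
  ln (lambda * (1 + mu) / (1 + mu * lambda)).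

(** The minimiser of exp (- t lambda / rho) rho / (rho - t) in t: the
    logarithmic derivative vanishes when rho - t = rho / lambda. *)
Definition exponential_tilt {R : realType} (rho lambda : R) : R :=
  rho * (1 - lambda^-1).

Section optimal_exponent.
Context {R : realType} {d : measure_display} {T : measurableType d}.
Variable P : probability T R.

(** At this exponent the moment generating function equals
    M = (1 + mu lambda) / (1 + mu), and t = ln lambda - ln M, so that the
    Chernoff bound exp (- t lambda mu) M is exactly exp (- H lambda mu). *)
Lemma geometric_sample_mean_tail (n : nat) (p mu lambda : R)
    (X : 'I_n -> {RV P >-> R}) :
    (0 < n)%N -> 0 < lambda -> 0 < mu -> (forall i, is_geometric p (X i)) ->
    (forall i, 'E_P[X i] = mu%:E)%E -> independent X ->
  (P [set w | (geometric_tilt mu lambda * (lambda * mu)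
                <= geometric_tilt mu lambda * sample_mean X w)%R]
    <= (expR (- (n%:R * H lambda mu)))%:E)%E.
Proof.
move=> n0 l0 mu0 gX EX indX; set t := geometric_tilt mu lambda.
have i0 : 'I_n := Ordinal n0.
have [/andP[p0 p1] _] := gX i0.
have muE : mu = (1 - p) / p := geometric_mean (gX i0) (EX i0).
have pmu : p * (1 + mu) = 1 by rewrite muE; field; rewrite gt_eqF.
have m1 : 0 < 1 + mu by rewrite addr_gt0.
have m2 : 0 < 1 + mu * lambda by rewrite addr_gt0 // mulr_gt0.
have pE : p = (1 + mu)^-1.
  by apply: (@mulIf _ (1 + mu)); rewrite ?pmu ?mulVf // gt_eqF.
have expt : expR t = lambda * (1 + mu) / (1 + mu * lambda).
  by rewrite /t /geometric_tilt lnK // posrE divr_gt0 // mulr_gt0.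
have qt : 1 - (1 - p) * expR t = (1 + mu * lambda)^-1.
  by rewrite expt pE; field; rewrite !gt_eqF.
have mgfX i : (\int[P]_w (expR (t * X i w))%:E
    = ((1 + mu * lambda) / (1 + mu))%:E)%E.
  rewrite (mgf_geometric (gX i)); last by rewrite -subr_gt0 qt invr_gt0.
  by rewrite qt invrK pE mulrC.
rewrite (le_trans (chernoff_sample_mean (lambda * mu) n0 indX mgfX)) // lee_fin.
rewrite -(mulrN n%:R) expRM_natl lerXn2r ?nnegrE ?expR_ge0 //.
  by rewrite mulr_ge0 ?expR_ge0 // divr_ge0 // ltW.
set M := (1 + mu * lambda) / (1 + mu).
have M0 : 0 < M by rewrite divr_gt0.
rewrite -[X in _ * X]lnK ?posrE // -expRD ler_expR.
have -> : t = ln lambda - ln M.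
  by rewrite -ln_div ?posrE // /M invf_div mulrA.
by rewrite /H -/M; lra.
Qed.

(** At this exponent the moment generating function equals lambda and
    t lambda mu = lambda - 1, so that the Chernoff bound is exactly
    exp (- G lambda). *)
Lemma exponential_sample_mean_tail (n : nat) (rho mu lambda : R)
    (Y : 'I_n -> {RV P >-> R}) :
    (0 < n)%N -> 0 < lambda -> (forall i, is_exponential rho (Y i)) ->
    (forall i, 'E_P[Y i] = mu%:E)%E -> independent Y ->
  (P [set w | (exponential_tilt rho lambda * (lambda * mu)
                <= exponential_tilt rho lambda * sample_mean Y w)%R]
    <= (expR (- (n%:R * G lambda)))%:E)%E.
Proof.
move=> n0 l0 eY EY indY; set t := exponential_tilt rho lambda.
have i0 : 'I_n := Ordinal n0.
have [rho0 _] := eY i0.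
have muE : mu = rho^-1 := exponential_mean (eY i0) (EY i0).
have tE : rho - t = rho / lambda by rewrite /t /exponential_tilt; ring.
have mgfY i : (\int[P]_w (expR (t * Y i w))%:E = lambda%:E)%E.
  rewrite (mgf_exponential (eY i)); last by rewrite -subr_gt0 tE divr_gt0.
  by rewrite tE invf_div mulrC divfK // gt_eqF.
rewrite (le_trans (chernoff_sample_mean (lambda * mu) n0 indY mgfY)) // lee_fin.
rewrite -(mulrN n%:R) expRM_natl lerXn2r ?nnegrE ?expR_ge0 //.
  by rewrite mulr_ge0 ?expR_ge0 // ltW.
rewrite -[X in _ * X]lnK ?posrE // -expRD ler_expR /G /t /exponential_tilt muE.
rewrite le_eqVlt; apply/orP; left; apply/eqP; field.
by rewrite !gt_eqF.
Qed.

End optimal_exponent.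

Theorem theorem1 (R : realType) (mu : R) (n : nat)
    (mu_gt0 : 0 < mu) (n_gt0 : (1 <= n)%N) :
  (forall (d : measure_display) (T : measurableType d) (P : probability T R)
      (p : R) (X : 'I_n -> {RV P >-> R}),
    (forall i, is_geometric p (X i)) ->
    (forall i, 'E_P[X i] = mu%:E)%E ->
    independent X ->
    (forall lambda : R, 1 < lambda ->
      (P [set w | (lambda * mu <= sample_mean X w)%R]
        <= (expR (- (n%:R * H lambda mu)))%:E)%E) /\
    (forall lambda : R, 0 < lambda < 1 ->
      (P [set w | (sample_mean X w <= lambda * mu)%R]
        <= (expR (- (n%:R * H lambda mu)))%:E)%E)) /\
  (forall (d : measure_display) (T : measurableType d) (P : probability T R)
      (rho : R) (Y : 'I_n -> {RV P >-> R}),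
    (forall i, is_exponential rho (Y i)) ->
    (forall i, 'E_P[Y i] = mu%:E)%E ->
    independent Y ->
    (forall lambda : R, 1 < lambda ->
      (P [set w | (lambda * mu <= sample_mean Y w)%R]
        <= (expR (- (n%:R * G lambda)))%:E)%E) /\
    (forall lambda : R, 0 < lambda < 1 ->
      (P [set w | (sample_mean Y w <= lambda * mu)%R]
        <= (expR (- (n%:R * G lambda)))%:E)%E)).
Proof.
(* In each case the tail event is multiplied by the exponent, whose sign is that
   of lambda - 1. *)
split=> [d T P p X gX EX indX|d T P rho Y eY EY indY].
- have tail lambda (l0 : 0 < lambda) :=
    geometric_sample_mean_tail n_gt0 l0 mu_gt0 gX EX indX.
  have base lambda : 0 < lambda -> 0 < 1 + mu * lambda.
    by move=> l0; rewrite addr_gt0 // mulr_gt0.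
  split=> [lambda l1|lambda /andP[l0 l1]].
  + have l0 : 0 < lambda := lt_trans ltr01 l1.
    have t0 : 0 < geometric_tilt mu lambda.
      by rewrite ln_gt0 // ltr_pdivlMr ?base //; lra.
    by under eq_set do rewrite -(ler_pM2l t0); exact: tail.
  + have t0 : geometric_tilt mu lambda < 0.
      apply: ln_lt0; rewrite ltr_pdivrMr ?base // divr_gt0 ?base //; first lra.
      by rewrite mulr_gt0 // addr_gt0.
    by under eq_set do rewrite -(ler_nM2l t0); exact: tail.
- have [rho0 _] := eY (Ordinal n_gt0).
  have tail lambda (l0 : 0 < lambda) :=
    exponential_sample_mean_tail n_gt0 l0 eY EY indY.
  split=> [lambda l1|lambda /andP[l0 l1]].
  + have l0 : 0 < lambda := lt_trans ltr01 l1.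
    have t0 : 0 < exponential_tilt rho lambda.
      by rewrite mulr_gt0 // subr_gt0 invf_lt1.
    by under eq_set do rewrite -(ler_pM2l t0); exact: tail.
  + have t0 : exponential_tilt rho lambda < 0.
      by rewrite pmulr_rlt0 // subr_lt0 invf_gt1.
    by under eq_set do rewrite -(ler_nM2l t0); exact: tail.
Qed.
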